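(* Let $b\in\mathbb{R}$ and $\rho\in\mathbb{R}$. The exterior Dirichlet problem $$\det D^2u=\Delta u\ \text{ in }\mathbb{R}^2\setminus\overline{B_1},\qquad u=b\ \text{ on }\partial B_1$$ has a unique solution $u\in\Phi_2$ satisfying, for a constant $c$, $$u(x)=|x|^2+\frac{\rho}{2}\ln|x|+c+O(|x|^{-2}),\quad |x|\to\infty,$$ if and only if $\rho\geq-1$, where $c=\nu(\rho)$ and $$\nu(\rho)=b-\frac12+\frac{\rho}{4}+\frac{\rho}{2}\ln2-\frac12\left[\sqrt{1+\rho}+\rho\ln(1+\sqrt{1+\rho})\right].$$
   Context: $B_1$ is the unit ball of $\mathbb{R}^2$. $\Phi_2$ is the set of functions $u\in C^1(\mathbb{R}^2\setminus B_1)\cap C^2(\mathbb{R}^2\setminus\overline{B_1})$ that are radially symmetric and uniformly $2$-convex, i.e. the eigenvalues $(\lambda_1,\lambda_2)$ of $D^2u$ satisfy $\lambda_1+\lambda_2>0$ and $\lambda_1\lambda_2>0$ at every point of $\mathbb{R}^2\setminus\overline{B_1}$. *)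

(* Defs.v *)
From mathcomp Require Import all_boot all_order all_algebra.
From mathcomp Require Import all_classical all_reals all_analysis.

Set Implicit Arguments.
Unset Strict Implicit.
Unset Printing Implicit Defensive.

Import Order.TTheory GRing.Theory Num.Theory.
Import numFieldNormedType.Exports.

Local Open Scope classical_set_scope.
Local Open Scope ring_scope.

(* The library norm on row vectors is the sup norm; |x| below is Euclidean. *)
Definition enorm (R : realType) (n : nat) (x : 'rV[R]_n) : R :=
  Num.sqrt (\sum_(i < n) x ord0 i ^+ 2).

Definition basis_vec (R : realType) (n : nat) (i : 'I_n) : 'rV[R]_n :=
  delta_mx ord0 i.

Definition hessian (R : realType) (n : nat) (u : 'rV[R]_n -> R) (x : 'rV[R]_n)
    : 'M[R]_n :=
  \matrix_(i < n, j < n)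
    ('D_(basis_vec R i) (fun y => 'D_(basis_vec R j) u y) x : R).

Definition laplacian (R : realType) (n : nat) (u : 'rV[R]_n -> R)
    (x : 'rV[R]_n) : R :=
  \sum_(i < n) ('D_(basis_vec R i) (fun y => 'D_(basis_vec R i) u y) x : R).

(* C^k(S) for a set S that need not be open: u is C^k in the interior of S and
   u and its partial derivatives of order at most k have continuous extensions
   to S (the function g is the extension of the i-th partial derivative).
   Only the values of u on S matter, and for S open this is the usual C^k. *)
Fixpoint Ck_on (R : realType) (n k : nat) (S : set 'rV[R]_n)
    (u : 'rV[R]_n -> R) : Prop :=
  {within S, continuous u} /\
  match k with
  | 0%N => True
  | k'.+1 => forall i : 'I_n, exists g : 'rV[R]_n -> R,
      Ck_on k' S g /\
      forall x, S° x -> is_derive x (basis_vec R i) u (g x)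
  end.

Definition ext_closed {R : realType} : set 'rV[R]_2 := [set x | 1 <= enorm x].
Definition ext_open {R : realType} : set 'rV[R]_2 := [set x | 1 < enorm x].
Definition unit_circle {R : realType} : set 'rV[R]_2 := [set x | enorm x = 1].

Definition radial_on (R : realType) (n : nat) (S : set 'rV[R]_n)
    (u : 'rV[R]_n -> R) : Prop :=
  exists f : R -> R, forall x, S x -> u x = f (enorm x).

(* l1, l2 are the eigenvalues of A, listed with multiplicity *)
Definition eigenvalues2 (R : realType) (A : 'M[R]_2) (l1 l2 : R) : Prop :=
  char_poly A = ('X - l1%:P) * ('X - l2%:P).

Definition uniformly_2convex (R : realType) (u : 'rV[R]_2 -> R) : Prop :=
  forall x, ext_open x ->
    exists l1 l2 : R,
      [/\ eigenvalues2 (hessian u x) l1 l2, 0 < l1 + l2 & 0 < l1 * l2].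

Definition Phi2 (R : realType) (u : 'rV[R]_2 -> R) : Prop :=
  [/\ Ck_on 1 ext_closed u, Ck_on 2 ext_open u,
      radial_on ext_closed u & uniformly_2convex u].

Definition dirichlet_solution (R : realType) (b : R) (u : 'rV[R]_2 -> R)
    : Prop :=
  (forall x, ext_open x -> \det (hessian u x) = laplacian u x) /\
  (forall x, unit_circle x -> u x = b).

Definition asymptotic (R : realType) (rho c : R) (u : 'rV[R]_2 -> R) : Prop :=
  exists C r0 : R, forall x, ext_closed x -> r0 <= enorm x ->
    `|u x - (enorm x ^+ 2 + rho / 2 * ln (enorm x) + c)| <= C * enorm x ^- 2.

Definition nu (R : realType) (b rho : R) : R :=
  b - 1 / 2 + rho / 4 + rho / 2 * ln 2
  - 1 / 2 * (Num.sqrt (1 + rho) + rho * ln (1 + Num.sqrt (1 + rho))).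

Definition admissible_solution (R : realType) (b rho : R) (u : 'rV[R]_2 -> R)
    : Prop :=
  [/\ Phi2 u, dirichlet_solution b u & exists c : R, asymptotic rho c u].

(* Main.v *)
Require Import Defs.
From mathcomp Require Import all_boot all_order all_algebra.
From mathcomp Require Import all_classical all_reals all_analysis.
From mathcomp Require Import ring lra.

Import Order.TTheory GRing.Theory Num.Theory.
Import numFieldNormedType.Exports.

Local Open Scope classical_set_scope.
Local Open Scope ring_scope.

(* For u(x) = f(|x|) with p = f', the eigenvalues of D^2 u are p' and p / r, so
   the equation reads p' p = r p' + p, that is, p^2 - 2 r p = K is constant.
   2-convexity makes both eigenvalues positive, and then p' (p - r) = p forces
   p > r, which selects the root p = r + sqrt (r^2 + K) and requires
   r^2 + K > 0 for all r > 1, i.e. K >= -1. The primitive of p is elementary,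
   and its expansion at infinity is r^2 + K/2 ln r + const + O(r^-2), so the
   asymptotic condition means K = rho and determines the constant. *)

(** * Two-by-two linear algebra: determinant, trace and eigenvalues *)

Lemma sum_ord2 (V : nmodType) (F : 'I_2 -> V) : \sum_(i < 2) F i = F 0 + F 1.
Proof.
rewrite !big_ord_recl big_ord0 addr0.
by congr (F _ + F _); apply: val_inj.
Qed.

Lemma ord2P (P : 'I_2 -> Prop) : P 0 -> P 1 -> forall i, P i.
Proof.
move=> P0 P1 [[|[|//]] h].
- by have -> : Ordinal h = 0 by apply: val_inj.
- by have -> : Ordinal h = 1 by apply: val_inj.
Qed.

Lemma det_mx2 (R : comPzRingType) (A : 'M[R]_2) :
  \det A = A 0 0 * A 1 1 - A 0 1 * A 1 0.
Proof.
rewrite (expand_det_row _ 0) sum_ord2 /cofactor !det_mx11 !mxE /=.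
rewrite expr0 mul1r expr1 mulN1r mulrN.
by congr (_ * A _ _ - _ * A _ _); apply: val_inj.
Qed.

Section Eigenvalues.
Variables (R : realType) (A : 'M[R]_2).

(** Both polynomials are monic of degree 2, so they agree as soon as the coefficients of degree 0
    and 1 do. *)
Lemma eigenvalues2_trace_det (l1 l2 : R) :
  eigenvalues2 A l1 l2 <-> l1 + l2 = \tr A /\ l1 * l2 = \det A.
Proof.
have c1 (l m : R) : (('X - l%:P) * ('X - m%:P))`_1 = - (l + m).
  rewrite coefM sum_ord2 !coefB !coefX !coefC /=; ring.
have c0 (l m : R) : (('X - l%:P) * ('X - m%:P))`_0 = l * m.
  rewrite coefM big_ord1 !coefB !coefX !coefC /=; ring.
have t1 := @char_poly_trace _ _ A isT.
have t0 := @char_poly_det _ _ A.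
rewrite sqrrN expr1n mul1r in t0.
rewrite /eigenvalues2; split=> [e|[htr hdet]].
- by rewrite -t0 -[\tr A]opprK -t1 e c1 c0 opprK.
- have sz : size (char_poly A) = 3 by exact: size_char_poly.
  have sz' : size (('X - l1%:P) * ('X - l2%:P)) = 3.
    by rewrite size_mul ?polyXsubC_eq0 // !size_XsubC.
  apply/polyP => i; case: i => [|[|[|i]]].
  + by rewrite c0 t0 hdet.
  + by rewrite c1 t1 htr.
  + have /monicP := char_poly_monic A; rewrite lead_coefE sz /= => ->.
    have /monicP : ('X - l1%:P) * ('X - l2%:P) \is monic.
      by rewrite monicMl monicXsubC.
    by rewrite lead_coefE sz' /= => ->.
  + by rewrite !nth_default ?sz ?sz'.
Qed.

End Eigenvalues.

(** * The Euclidean norm on the plane and first derivatives of radial functions *)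

Section Radial.
Variable R : realType.
Implicit Types (x y : 'rV[R]_2) (f g : R -> R) (r s t : R).

Lemma enorm2E x : enorm x = Num.sqrt (x 0 0 ^+ 2 + x 0 1 ^+ 2).
Proof. by rewrite /enorm sum_ord2. Qed.

Lemma sqr_enorm2 x : enorm x ^+ 2 = x 0 0 ^+ 2 + x 0 1 ^+ 2.
Proof. by rewrite enorm2E sqr_sqrtr// addr_ge0 ?sqr_ge0. Qed.

Lemma enorm2Z t x : enorm (t *: x) = `|t| * enorm x.
Proof.
by rewrite !enorm2E !mxE !exprMn -mulrDr sqrtrM ?sqr_ge0// sqrtr_sqr.
Qed.

Lemma continuous_enorm2 : continuous (@enorm R 2).
Proof.
move=> x; have -> : @enorm R 2 =
    fun y => Num.sqrt (y 0 0 ^+ 2 + y 0 1 ^+ 2).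
  by apply/funext => y; rewrite enorm2E.
apply: (@continuous_comp _ _ _ (fun y : 'rV[R]_2 => y 0 0 ^+ 2 + y 0 1 ^+ 2)).
  have h (i : 'I_2) : (fun y : 'rV[R]_2 => y 0 i) @ x --> x 0 i.
    exact: coord_continuous.
  exact: (cvgD (cvgM (h 0) (h 0)) (cvgM (h 1) (h 1))).
exact: sqrt_continuous.
Qed.

Lemma open_ext_open : open (@ext_open R).
Proof.
apply: (open_comp (f := @enorm R 2) (D := [set r | 1 < r])).
  by move=> x _; exact: continuous_enorm2.
exact: open_gt.
Qed.

(** The two difference quotients are the same function of [h]. This turns directional derivatives
    into one-variable ones, to which [is_derive1_comp] applies. *)
Lemma is_derive_line (V : normedModType R) (u : V -> R) (x v : V) (d : R) :
  is_derive x v u d <-> is_derive (0 : R) (1 : R) (fun t => u (t *: v + x)) d.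
Proof.
have e : (fun h : R => h^-1 *: ((u \o shift x) (h *: v) - u x)) =
  (fun h : R => h^-1 *: (((fun t => u (t *: v + x)) \o shift (0:R)) (h *: (1:R))
     - u ((0:R) *: v + x))).
  apply/funext => h /=; rewrite scale0r add0r /shift /= addr0.
  by rewrite /GRing.scale /= mulr1.
split=> -[h1 h2]; split.
- by rewrite /derivable -e.
- by rewrite /derive -e.
- by rewrite /derivable e.
- by rewrite /derive e.
Qed.

Lemma is_derive_coord x (i j : 'I_2) :
  is_derive x (basis_vec R i) (fun y => y 0 j) ((i == j)%:R : R).
Proof.
apply/is_derive_line.
have -> : (fun t => (t *: basis_vec R i + x) 0 j) =
   (fun t => (i == j)%:R * t + x 0 j).
  by apply/funext => t; rewrite !mxE /= mulrC eq_sym.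
by apply: is_derive_eq; rewrite addr0 /GRing.scale /= mulr1 ?mulr0 ?addr0.
Qed.

Lemma is_derive_enorm2 x (i : 'I_2) : 0 < enorm x ->
  is_derive x (basis_vec R i) (@enorm R 2) (x 0 i / enorm x).
Proof.
move=> x0.
have e : @enorm R 2 = Num.sqrt \o (fun y => y 0 0 ^+ 2 + y 0 1 ^+ 2).
  by apply/funext => y; rewrite enorm2E.
apply/is_derive_line; rewrite {1}e.
have h0 : is_derive x (basis_vec R i) (fun y => y 0 0 ^+ 2 + y 0 1 ^+ 2)
   (2 * x 0 i).
  have d0 := is_derive_coord x i 0.
  have d1 := is_derive_coord x i 1.
  apply: is_derive_eq.
  move: i {d0 d1}; apply: ord2P => /=; rewrite /GRing.scale /=; ring.
move/is_derive_line : h0 => h0.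
have h1 : 0 < (0 *: basis_vec R i + x) 0 0 ^+ 2 + (0 *: basis_vec R i + x) 0 1 ^+ 2.
  by rewrite scale0r add0r -sqr_enorm2 exprn_gt0.
have h2 := @is_derive1_comp _ Num.sqrt (fun t =>
    (t *: basis_vec R i + x) 0 0 ^+ 2 + (t *: basis_vec R i + x) 0 1 ^+ 2)
    _ _ _ (is_derive1_sqrt h1) h0.
apply: (is_derive_eq h2); rewrite scale0r add0r -enorm2E.
field. by rewrite gt_eqF.
Qed.

Lemma is_derive_radial f x (i : 'I_2) (d : R) : 0 < enorm x ->
  is_derive (enorm x) 1 f d ->
  is_derive x (basis_vec R i) (fun y => f (enorm y)) (d * (x 0 i / enorm x)).
Proof.
move=> x0 fd; apply/is_derive_line.
have /is_derive_line h := is_derive_enorm2 x i x0.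
have fd' : is_derive (enorm (0 *: basis_vec R i + x)) 1 f d.
  by rewrite scale0r add0r.
exact: (@is_derive1_comp _ f (fun t => enorm (t *: basis_vec R i + x))
  _ _ _ fd' h).
Qed.

End Radial.

(** * The Hessian of a radial function *)

Section RadialHessian.
Variables (R : realType) (u : 'rV[R]_2 -> R) (f p p' : R -> R).
Hypothesis u_radial : forall x, ext_open x -> u x = f (enorm x).
Hypothesis f_deriv : forall r : R, 1 < r -> is_derive r (1 : R) f (p r).

Lemma near_ext_open (x : 'rV[R]_2) : ext_open x -> \near x, ext_open x.
Proof. by move=> x1; apply: open_nbhs_nbhs; split => //; exact: open_ext_open. Qed.

Lemma is_derive_radial_partial x i : ext_open x ->
  is_derive x (basis_vec R i) u (p (enorm x) * (x 0 i / enorm x)).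
Proof.
move=> x1; have x0 : 0 < enorm x by rewrite (lt_trans ltr01).
apply: (near_eq_is_derive (f := fun y => f (enorm y))).
  by near=> y; rewrite u_radial//; near: y; exact: near_ext_open.
by apply: is_derive_radial => //; exact: f_deriv.
Unshelve. all: by end_near. Qed.

Hypothesis p_deriv : forall r : R, 1 < r -> is_derive r (1 : R) p (p' r).

(** Product rule for the radial factor [p r / r] and the coordinate [y 0 j]. The result is a
    multiple of the identity plus a rank-one matrix, with eigenvalue [p'] in the radial direction
    and [p / r] in the tangential one. *)
Lemma is_derive_radial_partial2 x i j : ext_open x ->
  is_derive x (basis_vec R i) (fun y => p (enorm y) * (y 0 j / enorm y))
    ((i == j)%:R * (p (enorm x) / enorm x) +
     (p' (enorm x) - p (enorm x) / enorm x) * (x 0 i * x 0 j / enorm x ^+ 2)).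
Proof.
move=> x1; have x0 : 0 < enorm x by rewrite (lt_trans ltr01).
have xn0 : enorm x != 0 by rewrite gt_eqF.
have -> : (fun y : 'rV[R]_2 => p (enorm y) * (y 0 j / enorm y)) =
  (fun y => p (enorm y) / enorm y) * (fun y => y 0 j).
  by apply/funext => y /=; rewrite mulrA mulrAC.
have pd := p_deriv _ x1.
have Vd : is_derive (enorm x) (1 : R) (fun r : R => r^-1) (- enorm x ^- 2).
  have h := @is_deriveV _ id (enorm x) 1 1 xn0 (is_derive_id _ _).
  by apply: (is_derive_eq h); rewrite /GRing.scale /= mulr1.
have qd : is_derive (enorm x) 1 (fun r => p r / r)
  ((p' (enorm x) - p (enorm x) / enorm x) / enorm x).
  apply: (is_derive_eq (is_deriveM pd Vd)); rewrite /GRing.scale /=; field.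
  exact: xn0.
have h := is_deriveM (is_derive_radial _ _ x i _ x0 qd) (is_derive_coord _ x i j).
apply: (is_derive_eq h).
rewrite /GRing.scale /=; field.
exact: xn0.
Qed.

Lemma hessian_radial x i j : ext_open x ->
  hessian u x i j = (i == j)%:R * (p (enorm x) / enorm x) +
     (p' (enorm x) - p (enorm x) / enorm x) * (x 0 i * x 0 j / enorm x ^+ 2).
Proof.
move=> x1; rewrite /hessian mxE.
rewrite (near_eq_derive (g := fun y => p (enorm y) * (y 0 j / enorm y))).
  exact/derive_val/is_derive_radial_partial2.
near=> y; apply: derive_val; apply: is_derive_radial_partial.
by near: y; exact: near_ext_open.
Unshelve. all: by end_near. Qed.

Lemma trace_hessian_radial x : ext_open x ->
  \tr (hessian u x) = p' (enorm x) + p (enorm x) / enorm x.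
Proof.
move=> x1; have xn0 : enorm x != 0 by rewrite gt_eqF// (lt_trans ltr01).
rewrite /mxtrace sum_ord2 !hessian_radial//= /=.
set w := p' _ - _.
have e : x 0 0 ^+ 2 / enorm x ^+ 2 + x 0 1 ^+ 2 / enorm x ^+ 2 = 1.
  by rewrite -mulrDl -sqr_enorm2 divff// expf_neq0.
transitivity (2 * (p (enorm x) / enorm x) +
    w * (x 0 0 ^+ 2 / enorm x ^+ 2 + x 0 1 ^+ 2 / enorm x ^+ 2)); first by ring.
rewrite e /w; ring.
Qed.

Lemma laplacian_radial x : ext_open x ->
  laplacian u x = p' (enorm x) + p (enorm x) / enorm x.
Proof.
move=> x1; rewrite -trace_hessian_radial// /mxtrace.
by apply: eq_bigr => i _; rewrite /hessian mxE.
Qed.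

Lemma det_hessian_radial x : ext_open x ->
  \det (hessian u x) = p' (enorm x) * (p (enorm x) / enorm x).
Proof.
move=> x1; have xn0 : enorm x != 0 by rewrite gt_eqF// (lt_trans ltr01).
rewrite det_mx2 !hessian_radial//=.
have e : x 0 0 ^+ 2 / enorm x ^+ 2 + x 0 1 ^+ 2 / enorm x ^+ 2 = 1.
  by rewrite -mulrDl -sqr_enorm2 divff// expf_neq0.
set q := p _ / _; set v := p' _ - q.
(* The rank-one part has determinant zero, so [v] enters only linearly, through the trace of that
   part. *)
transitivity (q ^+ 2 + q * v * (x 0 0 ^+ 2 / enorm x ^+ 2 + x 0 1 ^+ 2 / enorm x ^+ 2)).
  ring.
rewrite e /v; ring.
Qed.

End RadialHessian.

(** * The explicit radial solution and its derivative *)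

Section Profile.
Variables (R : realType) (K : R).
Implicit Types r : R.

Definition slope r : R := r + Num.sqrt (r ^+ 2 + K).

(** A primitive of [slope]: the second summand is the classical primitive of
    [Num.sqrt (r ^+ 2 + K)]. *)
Definition profile r : R :=
  r ^+ 2 / 2 + (r * Num.sqrt (r ^+ 2 + K) + K * ln (slope r)) / 2.

Lemma is_derive_sqrt_shift r : 0 < r ^+ 2 + K ->
  is_derive r (1 : R) (fun s => Num.sqrt (s ^+ 2 + K)) (r / Num.sqrt (r ^+ 2 + K)).
Proof.
move=> h; have sn0 : Num.sqrt (r ^+ 2 + K) != 0 by rewrite gt_eqF ?sqrtr_gt0.
have d : is_derive r (1 : R) (fun s => s ^+ 2 + K) (2 * r).
  by apply: is_derive_eq; rewrite /GRing.scale /=; ring.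
apply: (is_derive_eq (@is_derive1_comp _ Num.sqrt (fun s => s ^+ 2 + K) _ _ _
  (is_derive1_sqrt h) d)).
by field.
Qed.

Lemma is_derive_slope r : 0 < r ^+ 2 + K ->
  is_derive r (1 : R) slope (1 + r / Num.sqrt (r ^+ 2 + K)).
Proof. by move=> h; have := is_derive_sqrt_shift _ h => h'; apply: is_derive_eq. Qed.

Lemma is_derive_profile r : 0 < r -> 0 < r ^+ 2 + K ->
  is_derive r (1 : R) profile (slope r).
Proof.
move=> r0 h; have s0 : 0 < Num.sqrt (r ^+ 2 + K) by rewrite sqrtr_gt0.
have p0 : 0 < slope r by rewrite addr_gt0.
have d1 := is_derive_sqrt_shift _ h.
have d2 := @is_derive1_comp _ (@ln R) slope _ _ _ (is_derive1_ln p0) (is_derive_slope _ h).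
rewrite /profile.
have -> : (fun r => r ^+ 2 / 2 + (r * Num.sqrt (r ^+ 2 + K) + K * ln (slope r)) / 2) =
  (fun r => 2^-1 * (r ^+ 2 + (r * Num.sqrt (r ^+ 2 + K) + K * (@ln R \o slope) r))).
  by apply/funext => s /=; field.
apply: is_derive_eq; rewrite /GRing.scale /= /slope.
have := sqr_sqrtr (ltW h); set s := Num.sqrt _ => sE.
(* Eliminating [K] in favour of the root [s] leaves a rational identity in [r] and [s]. *)
have -> : K = s ^+ 2 - r ^+ 2 by rewrite sE; ring.
field; rewrite !gt_eqF//.
Qed.

End Profile.

Arguments slope {R}.
Arguments profile {R}.

(** * Expansion at infinity and uniqueness of its coefficients *)

Section Asymptotics.
Variable R : realType.
Implicit Types a d r C : R.

Lemma ln_le_subr1 r : 0 < r -> ln r <= r - 1.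
Proof. by move=> r0; rewrite -{1}(subrKC 1 r) le_ln1Dx// ltrBrDl subrr. Qed.

(** With y = (r + s) / (2r), the upper bound is ln y <= y - 1; the lower bound is the same
    inequality for 1 / y, where 1 / y - 1 = (r - s) / (r + s) and r + s >= r. *)
Lemma normr_ln_le r s : 0 < r -> 0 <= s -> `|ln ((r + s) / (2 * r))| <= `|s - r| / r.
Proof.
move=> r0 s0; have rs0 : 0 < r + s by rewrite ltr_wpDr.
have r20 : 0 < 2 * r by rewrite mulr_gt0.
have y0 : 0 < (r + s) / (2 * r) by rewrite divr_gt0.
rewrite ler_norml; apply/andP; split; last first.
  apply: (le_trans (ln_le_subr1 _ y0)).
  have -> : (r + s) / (2 * r) - 1 = ((s - r) / 2) / r by field; rewrite gt_eqF.
  rewrite ler_pM2r ?invr_gt0//; have := ler_norm (s - r); have := normr_ge0 (s - r).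
  lra.
rewrite lerNl -lnV ?posrE//.
have yV0 : 0 < ((r + s) / (2 * r))^-1 by rewrite invr_gt0.
apply: (le_trans (ln_le_subr1 _ yV0)).
have -> : ((r + s) / (2 * r))^-1 - 1 = (r - s) / (r + s).
  by field; rewrite !gt_eqF.
rewrite distrC (le_trans (ler_norm _))// normrM [X in _ * X]ger0_norm ?invr_ge0 ?(ltW rs0)//.
by rewrite ler_wpM2l// lef_pV2 ?posrE// lerDl.
Qed.

(** With s the square root, K = (s - r)(r + s) gives |s - r| <= |K| / r. The error is exactly -(s -
    r)^2 / 4 plus K / 2 times the logarithm of (r + s) / (2r), and each of these two terms takes at
    most half of the bound. *)
Lemma profile_asymptotic (K : R) r : 0 < r -> 0 <= r ^+ 2 + K ->
  `|profile K r - (r ^+ 2 + K / 2 * ln r + (K / 4 + K / 2 * ln 2))|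
    <= K ^+ 2 * r ^- 2.
Proof.
move=> r0 h; rewrite /profile /slope.
have := sqr_sqrtr h; have := sqrtr_ge0 (r ^+ 2 + K).
set s := Num.sqrt _ => s0 sE.
have rs0 : 0 < r + s by rewrite ltr_wpDr.
have KE : K = (s - r) * (r + s).
  by rewrite -[LHS](addKr (r ^+ 2)) -sE; ring.
have lnE : ln ((r + s) / (2 * r)) = ln (r + s) - (ln 2 + ln r).
  by rewrite ln_div ?posrE ?mulr_gt0// lnM ?posrE.
have -> : r ^+ 2 / 2 + (r * s + K * ln (r + s)) / 2 -
   (r ^+ 2 + K / 2 * ln r + (K / 4 + K / 2 * ln 2)) =
   - ((s - r) ^+ 2 / 4) + K / 2 * ln ((r + s) / (2 * r)).
  by rewrite lnE [in X in _ - (_ + (X + _))]KE [in X in (X + _) = _]mulrC; field.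
have dle : `|s - r| <= `|K| / r.
  by rewrite ler_pdivlMr// KE normrM ler_wpM2l// ger0_norm ?(ltW rs0)// lerDl.
have d2 : (s - r) ^+ 2 <= K ^+ 2 * r ^- 2.
  rewrite -exprVn -exprMn -[leLHS]real_normK ?num_real// -[leRHS]real_normK ?num_real//.
  have -> : `|K * r^-1| = `|K| / r.
    by rewrite normrM [X in _ * X]ger0_norm// invr_ge0 (ltW r0).
  by rewrite lerXn2r ?nnegrE// ?divr_ge0// (ltW r0).
have lle : `|ln ((r + s) / (2 * r))| <= `|K| * r ^- 2.
  apply: (le_trans (normr_ln_le _ _ r0 s0)).
  by rewrite -exprVn expr2 mulrA ler_wpM2r// invr_ge0 (ltW r0).
have e1 : `|(s - r) ^+ 2 / 4| <= K ^+ 2 * r ^- 2 / 2.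
  rewrite ger0_norm ?(divr_ge0 (sqr_ge0 _))//.
  move: d2 (sqr_ge0 (s - r)); move: ((s - r) ^+ 2) (K ^+ 2 * _) => x y; lra.
have e2 : `|K / 2 * ln ((r + s) / (2 * r))| <= K ^+ 2 * r ^- 2 / 2.
  rewrite normrM normrM [X in _ * X * _]ger0_norm//.
  have -> : K ^+ 2 * r ^- 2 / 2 = `|K| / 2 * (`|K| * r ^- 2).
    by rewrite -[K ^+ 2]real_normK ?num_real//; field; rewrite gt_eqF.
  by rewrite ler_wpM2l// divr_ge0.
by rewrite (le_trans (ler_normD _ _))// normrN [leRHS]splitr lerD//.
Qed.

Lemma small_const_eq0 d C r0 :
  (forall r, r0 <= r -> `|d| <= C * r ^- 2) -> d = 0.
Proof.
move=> H; apply/eqP; rewrite -normr_eq0; apply/eqP/le_anti; rewrite normr_ge0 andbT.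
rewrite leNgt; apply/negP => d0.
(* At this radius |d| r^2 >= |d| r >= |C| + 1 > C, which contradicts the assumed bound. *)
pose r := Num.max r0 (Num.max 1 ((`|C| + 1) / `|d|)).
have r1 : 1 <= r by rewrite !le_max lexx orbT.
have r2 : (`|C| + 1) / `|d| <= r by rewrite !le_max lexx !orbT.
have rp : 0 < r by lra.
have /H : r0 <= r by rewrite le_max lexx.
rewrite ler_pdivlMr ?exprn_gt0//.
move: r2; rewrite ler_pdivrMr// => r2.
have := ler_norm C.
have : `|d| * r <= `|d| * r ^+ 2.
  by rewrite ler_pM2l// expr2 ler_pMr.
lra.
Qed.

(* Comparing the values at [r] and [r ^+ 2] eliminates [a]. *)
Lemma small_log_eq0 a d C r0 :
  (forall r, r0 <= r -> `|a * ln r + d| <= C * r ^- 2) -> a = 0 /\ d = 0.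
Proof.
move=> H.
have C0 : 0 <= C.
  pose r := Num.max r0 1.
  have rp : 0 < r by rewrite lt_max ltr01 orbT.
  have /H : r0 <= r by rewrite le_max lexx.
  by move/(le_trans (normr_ge0 _)); rewrite pmulr_lge0 ?invr_gt0 ?exprn_gt0.
(* Since ln (r^2) = 2 ln r, the value at r^2 minus twice the value at r is -d; the bounds C r^-4 and
   2 C r^-2 add up to at most 3 C r^-2 for r >= 1. *)
have d0 : d = 0.
  apply: (@small_const_eq0 d (3 * C) (Num.max r0 1)) => r.
  rewrite ge_max => /andP[rr0 r1].
  have rp : 0 < r by lra.
  have r2 : r <= r ^+ 2 by rewrite expr2 ler_pMr.
  have := H _ rr0; have := H _ (le_trans rr0 r2).
  rewrite lnXn// -[ln r *+ 2]mulr_natl.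
  have : C * r ^+ 2 ^- 2 <= C * r ^- 2.
    rewrite ler_wpM2l// lef_pV2 ?posrE ?exprn_gt0//.
    by rewrite lerXn2r ?nnegrE ?sqr_ge0 ?(ltW rp).
  rewrite -!mulrA; set x := C * r ^- 2; set y := C * _ => xy.
  rewrite !ler_norml => /andP[? ?] /andP[? ?]; apply/andP; split; lra.
(* For r >= e one has ln r >= 1, so the bound on a ln r also bounds the constant a. *)
split=> //; apply: (@small_const_eq0 a C (Num.max r0 (expR 1))) => r.
rewrite ge_max => /andP[rr0 r1].
apply: le_trans (H _ rr0); rewrite d0 addr0 normrM ler_peMr//.
have lr : 1 <= ln r by rewrite -[leLHS]expRK ler_ln ?posrE ?expR_gt0// (lt_le_trans _ r1) ?expR_gt0.
by rewrite (le_trans lr)// ler_norm.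
Qed.

End Asymptotics.

(** * Integration of the radial equation *)

Section RadialODE.
Variable R : realType.
Implicit Types (f p : R -> R) (K r s : R).

(** Mean value theorem on [[s, r]]. The endpoint [s] needs only continuity, so the lemma can start
    from the boundary radius 1. *)
Lemma derive0_cst_ray f s : (forall r, s < r -> is_derive r (1 : R) f 0) ->
  (forall r, {within `[s, r], continuous f}) -> forall r, s <= r -> f r = f s.
Proof.
move=> df cf r sr.
have dfI t : t \in `]s, r[ -> is_derive t (1 : R) f 0.
  by rewrite in_itv/= => /andP[st _]; exact: df.
have [t _] := MVT_segment sr dfI (cf r).
by rewrite mul0r => /eqP; rewrite subr_eq0 => /eqP.
Qed.

(** Positivity of [slope] suffices, which covers [K = -1] at [r = 1], where the square root vanishes
    and [is_derive_profile] does not apply. *)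
Lemma continuous_profile K r : 0 < slope K r -> {for r, continuous (profile K)}.
Proof.
move=> p0.
have ci : (fun t : R => t) @ r --> r by exact: cvg_id.
have c2 : (fun t : R => t ^+ 2) @ r --> r ^+ 2 by exact: exprn_continuous.
have cs : (fun t : R => Num.sqrt (t ^+ 2 + K)) @ r --> Num.sqrt (r ^+ 2 + K).
  apply: (cvg_comp _ _ (cvgD c2 (cvg_cst K))); exact: sqrt_continuous.
have cl : (fun t : R => ln (slope K t)) @ r --> ln (slope K r).
  apply: (cvg_comp _ _ (cvgD ci cs)); exact: continuous_ln.
exact: (cvgD (cvgM c2 (cvg_cst _))
  (cvgM (cvgD (cvgM ci cs) (cvgM (cvg_cst _) cl)) (cvg_cst _))).
Qed.

(** The hypotheses are positivity of the trace and the equation det = trace for a radial Hessian.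
    The equation says that p^2 - 2rp has zero derivative; its constant value is K. *)
Lemma slope_of_quadratic p p' :
  (forall r, 1 < r -> is_derive r (1 : R) p (p' r)) ->
  (forall r, 1 < r -> 0 < p' r + p r / r) ->
  (forall r, 1 < r -> p' r * (p r / r) = p' r + p r / r) ->
  exists K, forall r, 1 < r -> 0 < r ^+ 2 + K /\ p r = slope K r.
Proof.
move=> dp tr_gt0 det_tr.
have r_lt_p r : 1 < r -> r < p r.
  move=> r1; have r0 : 0 < r by lra.
  have := tr_gt0 _ r1; have := det_tr _ r1; set q := p r / r => e h.
  (* The product and the sum of [p' r] and [q] are equal and positive, so both factors are positive;
     then p' (q - 1) = q forces q > 1. *)
  have q1 : 1 < q by nra.
  by move: q1; rewrite /q ltr_pdivlMr// mul1r.
pose g r := p r ^+ 2 - 2 * r * p r.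
have dg r : 1 < r -> is_derive r (1 : R) g 0.
  move=> r1; have r0 : r != 0 by rewrite gt_eqF//; lra.
  have d := dp _ r1.
  have e : p' r * p r = r * p' r + p r.
    by have := congr1 ( *%R r) (det_tr _ r1); rewrite mulrDr mulrCA [r * (_ / _)]mulrC divfK.
  apply: is_derive_eq; rewrite /GRing.scale /=; lra.
(* The reference radius 2 is an arbitrary point beyond 1. [derive0_cst_ray] only moves to the right
   of its base point, so both radii are compared with their minimum. *)
have gE r : 1 < r -> g r = g 2.
  move=> r1; pose s := Num.min r 2.
  have s1 : 1 < s by rewrite lt_min r1 ltr1n.
  have gs t : s <= t -> g t = g s.
    apply: derive0_cst_ray => [w sw|w]; first by apply: dg; exact: lt_trans sw.
    apply: derivable_within_continuous => v.
    rewrite in_itv/= => /andP[sv _].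
    exact: (@ex_derive _ _ _ _ _ _ _ (dg _ (lt_le_trans s1 sv))).
  by rewrite !gs // ?ge_min ?lexx ?orbT.
exists (g 2) => r r1; rewrite -(gE _ r1) /slope.
have rp := r_lt_p _ r1.
(* Completing the square; p > r then fixes the sign of the root. *)
have -> : r ^+ 2 + g r = (p r - r) ^+ 2 by rewrite /g; ring.
rewrite sqrtr_sqr ger0_norm; last by lra.
split; last by ring.
by rewrite exprn_gt0// subr_gt0.
Qed.

End RadialODE.

(** * Classification, asymptotics and construction of the solutions *)

Section Dirichlet.
Variable R : realType.
Implicit Types (b K r s t : R) (u : 'rV[R]_2 -> R) (x : 'rV[R]_2).

Local Notation e0 := (basis_vec R (0 : 'I_2)).

Lemma enorm_ray s : 0 <= s -> enorm (s *: e0) = s.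
Proof.
move=> s0; rewrite enorm2Z ger0_norm// enorm2E !mxE /=.
by rewrite expr1n expr0n addr0 sqrtr1 mulr1.
Qed.

Lemma ext_open_ray s : 1 < s -> ext_open (s *: e0).
Proof. by move=> s1; rewrite /ext_open /= enorm_ray// ltW// (lt_trans ltr01). Qed.

Lemma is_derive_ray u s d : is_derive (s *: e0) e0 u d ->
  is_derive s (1 : R) (fun t => u (t *: e0)) d.
Proof.
have e : (fun h : R => h^-1 *: ((u \o shift (s *: e0)) (h *: e0) - u (s *: e0))) =
  (fun h : R => h^-1 *: (((fun t => u (t *: e0)) \o shift s) (h *: (1:R))
     - u (s *: e0))).
  by apply/funext => h /=; rewrite /shift /= -scalerDl [h *: 1]mulr1.
move=> -[h1 h2]; split.
- by rewrite /derivable -e.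
- by rewrite /derive -e.
Qed.

(** A point of norm 1 is not interior, since shrinking it slightly towards the origin leaves the
    set. *)
Lemma interior_ext_closed x : ext_closed° x -> ext_open x.
Proof.
move=> xi.
have : 1 <= enorm x by exact: interior_subset xi.
rewrite le_eqVlt => /orP[/eqP x1|//]; exfalso.
have c : (fun t : R => t *: x) @ (1 : R) --> x.
  rewrite -{2}[x]scale1r; apply: cvgZr_tmp; exact: cvg_id.
have := c _ xi => /nbhs_ballP[e /= e0' he].
(* The minimum keeps [t] within [e] of 1 and at least 1/2, so that [t] is its own absolute value and
   is less than 1. *)
pose t := 1 - Num.min (e / 2) (1 / 2).
have m0 : 0 < Num.min (e / 2) (1 / 2) by rewrite lt_min !divr_gt0.
have me : Num.min (e / 2) (1 / 2) < e by rewrite gt_min; apply/orP; left; lra.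
have m1 : Num.min (e / 2) (1 / 2) <= 1 / 2 by rewrite ge_min lexx orbT.
have : ext_closed (t *: x).
  apply: he; rewrite /ball /= /t.
  by rewrite opprB addrC subrK ger0_norm// ltW.
rewrite /ext_closed /= enorm2Z -x1 mulr1 ger0_norm /t; lra.
Qed.

(** Along the ray through [e0] the partial derivatives of [u] in that direction are the derivatives
    of the radial profile [f]. This yields the hypotheses of [slope_of_quadratic], and integration
    from the circle fixes the constant. *)
Lemma Phi2_dirichlet_profile b u : Phi2 u -> dirichlet_solution b u ->
  exists2 K : R, -1 <= K &
    forall x, ext_closed x -> u x = b + profile K (enorm x) - profile K 1.
Proof.
move=> [[cu _] [_ C2] [f uf] conv] [eqn bd].
have [g [[_ C1] dg]] := C2 0; have [h [_ dh]] := C1 0.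
have oE : (@ext_open R)° = ext_open by apply/interior_id; exact: open_ext_open.
rewrite oE in dg dh.
have fE s : 1 <= s -> f s = u (s *: e0).
  move=> s1; have s0 : 0 <= s by lra.
  by rewrite uf /ext_closed /= enorm_ray.
pose p s := g (s *: e0); pose p' s := h (s *: e0).
have df s : 1 < s -> is_derive s (1 : R) f (p s).
  move=> s1; apply: (near_eq_is_derive (f := fun t => u (t *: e0))).
    near=> t; rewrite fE// ltW//; near: t; exact: lt_nbhsr.
  exact/is_derive_ray/dg/ext_open_ray.
have dp s : 1 < s -> is_derive s (1 : R) p (p' s).
  by move=> s1; exact/is_derive_ray/dh/ext_open_ray.
have uf' x : ext_open x -> u x = f (enorm x) by move=> /ltW; exact: uf.
have tr_gt0 r : 1 < r -> 0 < p' r + p r / r.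
  move=> r1; have xr := ext_open_ray _ r1.
  have [l1 [l2 [/eigenvalues2_trace_det[+ _] + _]]] := conv _ xr.
  rewrite (trace_hessian_radial _ _ _ _ _ uf' df dp)// enorm_ray; last by lra.
  by move=> ->.
have det_tr r : 1 < r -> p' r * (p r / r) = p' r + p r / r.
  move=> r1; have r0 : 0 <= r by lra.
  have xr := ext_open_ray _ r1.
  have := eqn _ xr.
  rewrite (det_hessian_radial _ _ _ _ _ uf' df dp)//.
  by rewrite (laplacian_radial _ _ _ _ _ uf' df dp)// enorm_ray.
have [K HK] := slope_of_quadratic _ _ _ dp tr_gt0 det_tr.
have K1 : -1 <= K.
  rewrite leNgt; apply/negP => K1.
  (* At this radius r^2 + K vanishes, although it must be positive. *)
  have s1 : 1 < Num.sqrt (- K) by rewrite -sqrtr1 ltr_sqrt; lra.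
  have [+ _] := HK _ s1.
  by rewrite sqr_sqrtr ?addNr ?ltxx//; lra.
exists K => // x x1; rewrite uf//.
have f1 : f 1 = b.
  have e1 : enorm (1 *: e0) = 1 by rewrite enorm_ray.
  by rewrite fE// bd.
have cst : f (enorm x) - profile K (enorm x) = f 1 - profile K 1.
  apply: (derive0_cst_ray _ (fun r => f r - profile K r)) x1 => [r r1|r].
    have [h1 h2] := HK _ r1; have r0 : 0 < r by lra.
    have d1 := df _ r1; have d2 := is_derive_profile _ _ _ r0 h1.
    by apply: is_derive_eq; rewrite h2 subrr.
  (* Continuity up to radius 1: for [f] it is inherited from that of [u] on [ext_closed], because
     the ray maps [[1, r]] into this set. *)
  apply/subspace_continuousP => t; rewrite /= in_itv/= => /andP[t1 tr].
  apply: cvgB; last first.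
    have pt : 0 < slope K t by rewrite ltr_wpDr ?sqrtr_ge0//; lra.
    have cp : profile K @ t --> profile K t by exact: continuous_profile _ _ _ pt.
    exact: (cvg_within_filter _ cp).
  have -> : f t = u (t *: e0) by rewrite fE.
  have t0 : 0 <= t by lra.
  have cut : u @ within ext_closed (nbhs (t *: e0)) --> u (t *: e0).
    by move/subspace_continuousP : cu; apply; rewrite /ext_closed /= enorm_ray.
  have ray : (fun s : R => s *: e0) @ within `[1, r] (nbhs t) -->
      within ext_closed (nbhs (t *: e0)).
    have c : (fun s : R => s *: e0) @ t --> t *: e0.
      by apply: cvgZr_tmp; exact: cvg_id.
    move=> P PP; apply: (@filterS _ (nbhs t) _ _ _ _ (c _ PP)) => s /= Ps.
    rewrite in_itv/= => /andP[s1 _]; apply: Ps.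
    by rewrite /ext_closed /= enorm_ray//; lra.
  apply: cvg_trans (cvg_comp _ _ ray cut); apply: fmap_within_eq => s.
  by rewrite inE/= in_itv/= => /andP[s1 _]; rewrite fE.
rewrite -f1; lra.
Unshelve. all: by end_near. Qed.

(** The constant [nu b K] is b - [profile K 1] plus the constant term K / 4 + (K / 2) ln 2 in the
    expansion of [profile K]. *)
Lemma asymptotic_profile b K u :
  -1 <= K ->
  (forall x, ext_closed x -> u x = b + profile K (enorm x) - profile K 1) ->
  asymptotic K (nu b K) u.
Proof.
move=> K1 uE; exists (K ^+ 2), 0 => x x1 _; rewrite uE//.
have x0 : 0 < enorm x by rewrite (lt_le_trans ltr01).
have h : 0 <= enorm x ^+ 2 + K.
  have : 1 <= enorm x ^+ 2 by rewrite expr_ge1// ltW.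
  lra.
have e1 : profile K 1 =
    1 / 2 + (Num.sqrt (1 + K) + K * ln (1 + Num.sqrt (1 + K))) / 2.
  by rewrite /profile /slope expr1n; ring.
apply: le_trans (profile_asymptotic _ K _ x0 h).
by rewrite le_eqVlt; apply/orP; left; apply/eqP; congr (`|_|); rewrite e1 /nu; field.
Qed.

(** Along a ray the difference of the two expansions is a logarithm plus a constant, of size
    O(r^-2); [small_log_eq0] makes both coefficients vanish. *)
Lemma asymptotic_unique rho c rho' c' u :
  asymptotic rho c u -> asymptotic rho' c' u -> rho = rho' /\ c = c'.
Proof.
move=> [C [r0 H]] [C' [r0' H']].
have [r r1] : (rho - rho') / 2 = 0 /\ c - c' = 0.
  apply: (small_log_eq0 _ _ _ (C + C') (Num.max 1 (Num.max r0 r0'))) => r.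
  rewrite !ge_max => /and3P[r1 rr rr'].
  have r0p : 0 <= r by lra.
  have xE := enorm_ray _ r0p.
  have xr : ext_closed (r *: e0) by rewrite /ext_closed /= xE.
  have := H _ xr; have := H' _ xr; rewrite xE => /(_ rr') h' /(_ rr) h.
  have -> : (rho - rho') / 2 * ln r + (c - c') =
      (u (r *: e0) - (r ^+ 2 + rho' / 2 * ln r + c')) -
      (u (r *: e0) - (r ^+ 2 + rho / 2 * ln r + c)) by ring.
  by rewrite (le_trans (ler_normB _ _))// mulrDl addrC lerD.
split; lra.
Qed.

Lemma admissible_profile b K : -1 <= K ->
  admissible_solution b K
    (fun x => b + profile K (enorm x) - profile K 1).
Proof.
move=> K1; set u := fun x : 'rV[R]_2 => _.
pose f r := b + profile K r - profile K 1.
pose p' r := 1 + r / Num.sqrt (r ^+ 2 + K).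
have rK r : 1 < r -> 0 < r ^+ 2 + K.
  by move=> r1; rewrite expr2; nra.
have uf x : ext_open x -> u x = f (enorm x) by [].
have df r : 1 < r -> is_derive r (1 : R) f (slope K r).
  move=> r1; have r0 : 0 < r by lra.
  have d := is_derive_profile _ K _ r0 (rK _ r1).
  by apply: is_derive_eq; rewrite subr0 add0r mul1r.
have dp r : 1 < r -> is_derive r (1 : R) (slope K) (p' r).
  by move=> r1; exact/is_derive_slope/rK.
have p0 r : 1 <= r -> 0 < slope K r.
  by move=> r1; rewrite ltr_wpDr ?sqrtr_ge0//; lra.
have q_gt1 r : 1 < r -> 1 < slope K r / r.
  move=> r1; have r0 : 0 < r by lra.
  by rewrite ltr_pdivlMr// mul1r ltrDl sqrtr_gt0 rK.
(* The two eigenvalues exceed 1 by r / s and s / r, with s the square root; these have product 1,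
   which is the equation det = trace. *)
have sq r : 1 < r -> p' r * (slope K r / r) = p' r + slope K r / r.
  move=> r1; rewrite /p' /slope; have := rK _ r1; rewrite -sqrtr_gt0 => s0.
  by field; rewrite !gt_eqF//; lra.
have p'_gt0 r : 1 < r -> 0 < p' r.
  move=> r1; rewrite ltr_wpDr// divr_ge0 ?sqrtr_ge0//; lra.
have cn x : @enorm R 2 @ x --> enorm x by exact: continuous_enorm2.
have cx x (i : 'I_2) : (fun y : 'rV[R]_2 => y 0 i) @ x --> x 0 i.
  exact: coord_continuous.
have cV x : 1 <= enorm x -> (fun y : 'rV[R]_2 => (enorm y)^-1) @ x --> (enorm x)^-1.
  by move=> x1; apply: cvgV (cn x); rewrite gt_eqF//; lra.
have cs x : (fun y : 'rV[R]_2 => Num.sqrt (enorm y ^+ 2 + K)) @ x -->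
    Num.sqrt (enorm x ^+ 2 + K).
  apply: (cvg_comp _ _ (cvgD (cvgM (cn x) (cn x)) (cvg_cst K))).
  exact: sqrt_continuous.
have cp x : (fun y : 'rV[R]_2 => slope K (enorm y)) @ x --> slope K (enorm x).
  exact: (cvgD (cn x) (cs x)).
(* Unlike [u] and its gradient, this factor is handled only off the circle: for [K = -1] its
   denominator vanishes at radius 1. *)
have cp' x : 1 < enorm x ->
    (fun y : 'rV[R]_2 => p' (enorm y)) @ x --> p' (enorm x).
  move=> x1; have s0 : Num.sqrt (enorm x ^+ 2 + K) != 0.
    by rewrite gt_eqF// sqrtr_gt0 rK.
  exact: (cvgD (cvg_cst _) (cvgM (cn x) (cvgV s0 (cs x)))).
have cu x : 1 <= enorm x -> u @ x --> u x.
  move=> x1; have cf := cvg_comp _ _ (cn x) (continuous_profile _ _ _ (p0 _ x1)).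
  exact: (cvgB (cvgD (cvg_cst _) cf) (cvg_cst _)).
pose g (i : 'I_2) (y : 'rV[R]_2) := slope K (enorm y) * (y 0 i / enorm y).
have cg i x : 1 <= enorm x -> g i @ x --> g i x.
  by move=> x1; exact: (cvgM (cp x) (cvgM (cx x i) (cV x x1))).
pose h (i j : 'I_2) (y : 'rV[R]_2) := (i == j)%:R * (slope K (enorm y) / enorm y) +
  (p' (enorm y) - slope K (enorm y) / enorm y) * (y 0 i * y 0 j / enorm y ^+ 2).
have ch i j x : 1 < enorm x -> h i j @ x --> h i j x.
  move=> x1; have cVx := cV _ (ltW x1).
  have cq : (fun y : 'rV[R]_2 => slope K (enorm y) / enorm y) @ x -->
      slope K (enorm x) / enorm x by exact: (cvgM (cp x) cVx).
  have n0 : enorm x ^+ 2 != 0 by rewrite expf_neq0// gt_eqF//; lra.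
  have c2 : (fun y : 'rV[R]_2 => y 0 i * y 0 j / enorm y ^+ 2) @ x -->
      x 0 i * x 0 j / enorm x ^+ 2.
    exact: (cvgM (cvgM (cx x i) (cx x j)) (cvgV n0 (cvgM (cn x) (cn x)))).
  have c3 : (fun y : 'rV[R]_2 => (p' (enorm y) - slope K (enorm y) / enorm y) *
      (y 0 i * y 0 j / enorm y ^+ 2)) @ x -->
      (p' (enorm x) - slope K (enorm x) / enorm x) * (x 0 i * x 0 j / enorm x ^+ 2).
    exact: (cvgM (cvgB (cp' x x1) cq) c2).
  exact: (cvgD (cvgM (cvg_cst _) cq) c3).
have within_cts (S : set 'rV[R]_2) (w : 'rV[R]_2 -> R) :
    (forall x, S x -> w @ x --> w x) -> {within S, continuous w}.
  by move=> H; apply: continuous_in_subspaceT => x; rewrite inE; exact: H.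
have oE : (@ext_open R)° = ext_open by apply/interior_id; exact: open_ext_open.
have dg i x : ext_open x -> is_derive x (basis_vec R i) u (g i x).
  by move=> x1; exact: (is_derive_radial_partial _ _ _ _ uf df).
split.
- split.
  + split=> [|i]; first by apply: within_cts => x; exact: cu.
    exists (g i); split=> [|x /interior_ext_closed]; last exact: dg.
    by split=> //; apply: within_cts => x; exact: cg.
  + split=> [|i]; first by apply: within_cts => x /ltW; exact: cu.
    exists (g i); rewrite oE; split; last exact: dg.
    split=> [|j]; first by apply: within_cts => x /ltW; exact: cg.
    (* The indices are swapped because [h j i] is the derivative in direction [j] of the partial
       [g i]. *)
    exists (h j i); split=> [|x].
      by split=> //; apply: within_cts => x; exact: ch.
    rewrite oE; exact: (is_derive_radial_partial2 _ _ _ dp).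
  + by exists f.
  + move=> x x1; exists (p' (enorm x)), (slope K (enorm x) / enorm x).
    have x1' : 1 < enorm x by [].
    have q0 := lt_trans ltr01 (q_gt1 _ x1').
    split; [|by rewrite addr_gt0 ?p'_gt0|by rewrite mulr_gt0 ?p'_gt0].
    apply/eigenvalues2_trace_det.
    by rewrite (trace_hessian_radial _ _ _ _ _ uf df dp)//
      (det_hessian_radial _ _ _ _ _ uf df dp).
- split=> x x1.
    by rewrite (laplacian_radial _ _ _ _ _ uf df dp)//
      (det_hessian_radial _ _ _ _ _ uf df dp)// sq.
  by rewrite /u x1; lra.
- by exists (nu b K); exact: asymptotic_profile.
Qed.

End Dirichlet.

(* Functions are total on 'rV[R]_2 but stand for functions on the complement of
   the open unit ball, so uniqueness is equality there. *)
Theorem theorem1p2 (R : realType) (b rho : R) :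
  ((exists u : 'rV[R]_2 -> R,
      admissible_solution b rho u /\
      forall v : 'rV[R]_2 -> R, admissible_solution b rho v ->
        forall x, ext_closed x -> v x = u x)
   <-> -1 <= rho)
  /\
  (forall (u : 'rV[R]_2 -> R) (c : R),
     Phi2 u -> dirichlet_solution b u -> asymptotic rho c u ->
     c = nu b rho).
Proof.
(* Every solution with the expansion is the explicit one with K = [rho]. Necessity of the bound, the
   value of the constant and uniqueness all follow from this. *)
have key u c : Phi2 u -> dirichlet_solution b u -> asymptotic rho c u ->
    [/\ -1 <= rho, c = nu b rho & forall x, ext_closed x ->
      u x = b + profile rho (enorm x) - profile rho 1].
  move=> Pu du au; have [K K1 uE] := Phi2_dirichlet_profile _ _ _ Pu du.
  have [-> ->] := asymptotic_unique _ _ _ _ _ _ au (asymptotic_profile _ _ _ _ K1 uE).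
  by split.
split; last by move=> u c Pu du au; have [] := key u c Pu du au.
split=> [[u [[Pu du [c au]] _]]|rho1]; first by have [] := key u c Pu du au.
exists (fun x => b + profile rho (enorm x) - profile rho 1).
split=> [|v [Pv dv [c av]] x x1]; first exact: admissible_profile.
by have [_ _ ->] := key v c Pv dv av.
Qed.
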